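(* Let $p,q,r>0$ with $p+q+r=1$ and $q>p$. Consider the nearest-neighbor Markov chain on $\Omega=\{0,1,2,\dots\}$ with transition probabilities $P(0,1)=1$ and, for $n\ge 1$, $P(n,n-1)=q$, $P(n,n)=r$, $P(n,n+1)=p$, started at $X_0=0$. Let $Q_n$ be its orthogonal polynomials and $\psi$ its spectral measure (as defined in the context), let $\nu$ be its stationary distribution and $\mu_t$ the distribution of $X_t$. Then for all integers $t,n\ge 0$, $$\int_{(-1,1)} \lambda^t Q_n(\lambda)\, d\psi(\lambda) = \frac{(1+q-p)(q+r)-q}{(1+q-p)(q+r)}\left(-\frac{q}{q+r}\right)^{t+n} + \left(\sqrt{\frac{q}{p}}\right)^n \frac{p}{q+r}\cdot \frac{1}{2\pi i}\oint_{|z|=1}\frac{\left(\sqrt{pq}(z+z^{-1})+r\right)^t z^n (z-z^{-1})}{\left(z-\sqrt{\frac{p}{q}}\frac{r+(1+q-p)}{2(q+r)}\right)\left(z-\sqrt{\frac{p}{q}}\frac{r-(1+q-p)}{2(q+r)}\right)}\,dz,$$ and for every $t\ge 0$ the total variation distance satisfies $$\|\nu-\mu_t\|_{TV}\le A\left(\frac{q}{q+r}\right)^t + B\left(r+2\sqrt{pq}\right)^t,$$ where $$A=\frac{(1+q-p)(q+r)-q}{(1+q-p)(1-2p)},\qquad B=\frac{\frac{p}{q+r}\left(1+\frac{1}{\sqrt{pq}-p}\right)}{\left(1-\sqrt{\frac{p}{q}}\frac{r+(1+q-p)}{2(q+r)}\right)\left(1+\sqrt{\frac{p}{q}}\frac{r-(1+q-p)}{2(q+r)}\right)}.$$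 Consequently, as $\varepsilon\downarrow 0$, the mixing time satisfies $t_{mix}(\varepsilon)=O\!\left(\frac{\log \varepsilon}{\log m(p,q)}\right)$, where $m(p,q)=\max\left[r+2\sqrt{pq},\ \frac{q}{q+r}\right]$.
   Context: The contour $|z|=1$ is traversed counterclockwise. Reversibility measure: $\pi_0=1$, $\pi_n=p^{n-1}/q^n$ for $n\ge1$; $\rho=\sum_{n\ge0}\pi_n$ and the stationary distribution is $\nu=\pi/\rho$. Orthogonal polynomials: $Q_0(\lambda)=1$, $Q_1(\lambda)=\lambda$, and $\lambda Q_n(\lambda)=qQ_{n-1}(\lambda)+rQ_n(\lambda)+pQ_{n+1}(\lambda)$ for $n\ge1$ (so $(Q_n(\lambda))_n$ is the formal eigenvector $PQ=\lambda Q$). The spectral measure $\psi$ is the (Karlin–McGregor) probability measure on $[-1,1]$ for which $\int Q_iQ_j\,d\psi=\delta_{ij}/\pi_j$, equivalently $P^t(i,j)=\pi_j\int_{-1}^1\lambda^tQ_i(\lambda)Q_j(\lambda)\,d\psi(\lambda)$ for all $i,j,t$; the integral in the claim is over the open interval $(-1,1)$, excluding the atom at $1$. Total variation distance: $\|\nu-\mu\|_{TV}=\frac12\sum_{x\in\Omega}|\nu(x)-\mu(x)|$. Mixing time (from $X_0=0$): $t_{mix}(\varepsilon)=\min\{t:\|\nu-\mu_t\|_{TV}\le\varepsilon\}$. *)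

(* Defs.v *)
From HB Require Import structures.
From mathcomp Require Import all_boot all_order all_algebra.
From mathcomp Require Import all_classical all_reals all_analysis.
From mathcomp Require Import complex.
Set Implicit Arguments. Unset Strict Implicit. Unset Printing Implicit Defensive.
Import Order.TTheory GRing.Theory Num.Theory.
Import numFieldNormedType.Exports.
Local Open Scope classical_set_scope.
Local Open Scope ring_scope.

Section Chain.
Variables (R : realType) (p q r : R).

Definition trans (i j : nat) : R :=
  if i == 0%N then (if j == 1%N then 1 else 0)
  else if j == i.-1 then q else if j == i then r else if j == i.+1 then p else 0.

(* mu t j = P(X_t = j) with X_0 = 0; only states i <= j+1 can reach j *)
Fixpoint mu (t : nat) (j : nat) : R :=
  match t with
  | 0%N => if j == 0%N then 1 else 0
  | t'.+1 => \sum_(i < j.+2) mu t' i * trans i j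
  end.

Definition piR (n : nat) : R := if n == 0%N then 1 else p ^+ n.-1 / q ^+ n.

Definition rho : R := limn (fun N => \sum_(0 <= n < N) piR n).

Definition nu (n : nat) : R := piR n / rho.

Definition TV (t : nat) : \bar R :=
  ((2^-1)%:E * (\sum_(0 <= x <oo) (`|nu x - mu t x|)%:E)%E)%E.

Definition is_tmix (eps : R) (t : nat) : Prop :=
  (TV t <= eps%:E)%E /\ forall s : nat, (TV s <= eps%:E)%E -> (t <= s)%N.

Fixpoint Qpair (n : nat) (x : R) : R * R :=
  match n with
  | 0%N => (1, x)
  | n'.+1 => let (a, b) := Qpair n' x in (b, ((x - r) * b - q * a) / p)
  end.
Definition Q (n : nat) (x : R) : R := (Qpair n x).1.

Definition is_spectral_measure (psi : probability R R) : Prop :=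
  psi (~` `[(-1)%R, 1%R]) = 0%E /\
  forall i j : nat,
    (\int[psi]_(x in `[(-1)%R, 1%R]) (Q i x * Q j x)%:E)%E
      = ((if i == j then 1 else 0) / piR j)%:E.

Definition expi (th : R) : R[i] := (cos th +i* sin th)%C.

Definition cf (t n : nat) (z : R[i]) : R[i] :=
  let a1 := Num.sqrt (p / q) * (r + (1 + q - p)) / (2 * (q + r)) in
  let a2 := Num.sqrt (p / q) * (r - (1 + q - p)) / (2 * (q + r)) in
  (((Num.sqrt (p * q))%:C * (z + z^-1) + r%:C) ^+ t * z ^+ n * (z - z^-1)
    / ((z - a1%:C) * (z - a2%:C)))%C.

(* (1/(2 pi i)) \oint_{|z|=1} f(z) dz, with z = e^{i theta}, dz = i z dtheta,
   i.e. (1/(2pi)) int_0^{2pi} f(e^{i th}) e^{i th} dth, split into Re and Im *)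
Definition contour (f : R[i] -> R[i]) : R[i] :=
  let g := fun th => f (expi th) * expi th in
  ((Rintegral (@lebesgue_measure R) `[0, pi *+ 2] (fun th : R => complex.Re (g th)) / (pi *+ 2))
    +i* (Rintegral (@lebesgue_measure R) `[0, pi *+ 2] (fun th : R => complex.Im (g th)) / (pi *+ 2)))%C.

End Chain.

(* Main.v *)
(** Since 1 + q - p = 2q + r, the two poles are s = sqrt(p/q) and -s u with
u = q/(q+r), both inside the unit disc. The right-hand side of the formula plus
the constant 1/rho satisfies the three-term recurrence in (t, n): for n >= 1
because sqrt(pq)(z + 1/z) + r acts on sqrt(q/p)^n z^n as the transition operator,
and at n = 0 because sqrt(pq)(z + 1/z) + r - sqrt(q/p) z cancels the two poles
and leaves an integrand that is odd under z -> 1/z. At t = 0 partial fractions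
give the Kronecker delta. These properties determine the moments of psi over
[-1,1]. The moments with n = 0 tend to 1/rho while their part over (-1,1) tends
to 0, so psi has mass 1/rho at 1 and none at -1. The total variation bound follows
by summing the formula against pi_n, using |z - 1/z| <= 2 on the circle. *)
Require Import Defs.
From HB Require Import structures.
From mathcomp Require Import all_boot all_order all_algebra.
From mathcomp Require Import all_classical all_reals all_analysis.
From mathcomp Require Import complex.
From mathcomp Require Import measurable_realfun ring lra.
Import Order.TTheory GRing.Theory Num.Theory.
Import numFieldNormedType.Exports.
Local Open Scope classical_set_scope.
Local Open Scope ring_scope.
Set Implicit Arguments. Unset Strict Implicit. Unset Printing Implicit Defensive.

(** * Means over the unit circle *)

Section CircleMean.
Variable R : realType.
Implicit Types (f g : R -> R) (F G : R -> R[i]).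

Definition mean f : R :=
  Rintegral (@lebesgue_measure R) `[0, pi *+ 2] f / (pi *+ 2).

(** Split into components so that [contour f] unfolds to [cmean (fun x => f (expi x) * expi x)]. *)
Definition cmean F : R[i] :=
  (mean (fun x => complex.Re (F x)) +i* mean (fun x => complex.Im (F x)))%C.

Lemma twopi_gt0 : 0 < pi *+ 2 :> R.
Proof. by rewrite mulrn_wgt0// pi_gt0. Qed.

Lemma integrable_itv (a b : R) f : continuous f ->
  (@lebesgue_measure R).-integrable `[a, b] (EFin \o f).
Proof.
move=> cf; apply: continuous_compact_integrable; first exact: segment_compact.
exact: continuous_subspaceT.
Qed.

Lemma meanD f g : continuous f -> continuous g ->
  mean (fun x => f x + g x) = mean f + mean g.
Proof.
move=> cf cg; rewrite /mean RintegralD ?mulrDl//; exact: integrable_itv.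
Qed.

Lemma meanZ (a : R) f : continuous f -> mean (fun x => a * f x) = a * mean f.
Proof.
move=> cf; rewrite /mean RintegralZl ?mulrA//; exact: integrable_itv.
Qed.

Lemma lebesgue_twopi : fine (@lebesgue_measure R `[0, pi *+ 2]) = pi *+ 2.
Proof.
by rewrite lebesgue_measure_itv/= lte_fin twopi_gt0 -EFinB subr0.
Qed.

Lemma mean_cst (a : R) : mean (fun=> a) = a.
Proof.
by rewrite /mean Rintegral_cst// lebesgue_twopi mulfK// lt0r_neq0// twopi_gt0.
Qed.

Lemma le_normr_mean f (M : R) : continuous f ->
  (forall x, `|f x| <= M) -> `|mean f| <= M.
Proof.
move=> cf fM; rewrite /mean normrM normfV (gtr0_norm twopi_gt0).
rewrite ler_pdivrMr ?twopi_gt0//.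
apply: le_trans.
  by apply: le_normr_Rintegral => //; exact: integrable_itv.
rewrite -{2}lebesgue_twopi -Rintegral_cst//.
apply: le_Rintegral => //.
- by apply: integrable_itv => x; apply: continuous_comp; [exact: cf|exact: norm_continuous].
- by apply: integrable_itv => x; exact: cst_continuous.
Qed.

(** The fundamental theorem of calculus, for a primitive with equal values at both ends. The
    vanishing means of exponentials and of the odd integrand below come from it. *)
Lemma mean_derive f (P : R -> R) : continuous f ->
  (forall x, is_derive x (1 : R) P (f x)) -> P (pi *+ 2) = P 0 -> mean f = 0.
Proof.
move=> cf dP P0.
have cP x : {for x, continuous P}.
  by apply: differentiable_continuous; apply/derivable1_diffP; case: (dP x).
rewrite /mean /Rintegral (@continuous_FTC2 _ f P) ?twopi_gt0//.
- by rewrite -EFinB P0 subrr/= mul0r.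
- exact: continuous_subspaceT.
- split=> [x _| |]; first by case: (dP x).
  + exact: cvg_at_right_filter (cP 0).
  + exact: cvg_at_left_filter (cP _).
- by move=> x _; rewrite derive1E; case: (dP x).
Qed.

(** Continuity is asked of the two real components, since [cmean] integrates them separately. *)
Definition ccont F :=
  continuous (fun x => complex.Re (F x)) /\ continuous (fun x => complex.Im (F x)).

Lemma ccont_cst (z : R[i]) : ccont (fun=> z).
Proof. by split=> x; exact: cst_continuous. Qed.

Lemma ccontD F G : ccont F -> ccont G -> ccont (fun x => F x + G x).
Proof.
move=> [F1 F2] [G1 G2]; split=> x.
  rewrite (_ : (fun x => _) = (fun x => complex.Re (F x) + complex.Re (G x))).
    by apply: cvgD; [exact: F1|exact: G1].
  by apply/funext => y; case: (F y) (G y) => ? ? [? ?].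
rewrite (_ : (fun x => _) = (fun x => complex.Im (F x) + complex.Im (G x))).
  by apply: cvgD; [exact: F2|exact: G2].
by apply/funext => y; case: (F y) (G y) => ? ? [? ?].
Qed.

Lemma ccontN F : ccont F -> ccont (fun x => - F x).
Proof.
move=> [F1 F2]; split=> x.
  rewrite (_ : (fun x => _) = (fun x => - complex.Re (F x))).
    by apply: cvgN; exact: F1.
  by apply/funext => y; case: (F y).
rewrite (_ : (fun x => _) = (fun x => - complex.Im (F x))).
  by apply: cvgN; exact: F2.
by apply/funext => y; case: (F y).
Qed.

Lemma ccontM F G : ccont F -> ccont G -> ccont (fun x => F x * G x).
Proof.
move=> [F1 F2] [G1 G2]; split=> x.
  rewrite (_ : (fun x => _) = (fun x => complex.Re (F x) * complex.Re (G x)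
    - complex.Im (F x) * complex.Im (G x))).
    by apply: cvgB; apply: cvgM; [exact: F1|exact: G1|exact: F2|exact: G2].
  by apply/funext => y; case: (F y) (G y) => ? ? [? ?].
rewrite (_ : (fun x => _) = (fun x => complex.Re (F x) * complex.Im (G x)
    + complex.Im (F x) * complex.Re (G x))).
  by apply: cvgD; apply: cvgM; [exact: F1|exact: G2|exact: F2|exact: G1].
by apply/funext => y; case: (F y) (G y) => ? ? [? ?].
Qed.

(** With F = a + ib the inverse is (a - ib)/(a^2 + b^2), whose denominator vanishes only where F
    does. *)
Lemma ccontV F : ccont F -> (forall x, F x != 0) -> ccont (fun x => (F x)^-1).
Proof.
move=> [F1 F2] F0.
have cn : continuous (fun x => (complex.Re (F x) * complex.Re (F x) + complex.Im (F x) * complex.Im (F x))^-1).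
  move=> x; apply: cvgV.
    have := F0 x; case: (F x) => a b /=; apply: contra.
    rewrite -!expr2 paddr_eq0 ?sqr_ge0// !expf_eq0/= => /andP[/eqP-> /eqP->].
    exact: eqxx.
  by apply: cvgD; apply: cvgM; [exact: F1|exact: F1|exact: F2|exact: F2].
split=> x.
  rewrite (_ : (fun x => _) = (fun x => complex.Re (F x) *
      (complex.Re (F x) * complex.Re (F x) + complex.Im (F x) * complex.Im (F x))^-1)).
    by apply: cvgM; [exact: F1|exact: cn].
  by apply/funext => y; case: (F y) => ? ?; rewrite /= !expr2.
rewrite (_ : (fun x => _) = (fun x => - (complex.Im (F x) *
      (complex.Re (F x) * complex.Re (F x) + complex.Im (F x) * complex.Im (F x))^-1))).
  by apply: cvgN; apply: cvgM; [exact: F2|exact: cn].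
by apply/funext => y; case: (F y) => ? ?; rewrite /= !expr2 ?mulNr.
Qed.

Lemma ccontX F n : ccont F -> ccont (fun x => F x ^+ n).
Proof.
move=> cF; elim: n => [|n IHn]; first exact: ccont_cst.
rewrite (_ : (fun x => _) = (fun x => F x * F x ^+ n)); first exact: ccontM.
by apply/funext => x; rewrite exprS.
Qed.

Lemma ccont_expi : ccont (@expi R).
Proof. by split=> x; [exact: continuous_cos|exact: continuous_sin]. Qed.

Lemma eq_cmean F G : F =1 G -> cmean F = cmean G.
Proof. by move=> /funext ->. Qed.

Lemma cmeanD F G : ccont F -> ccont G ->
  cmean (fun x => F x + G x) = cmean F + cmean G.
Proof.
move=> [F1 F2] [G1 G2]; rewrite /cmean.
rewrite -[RHS]/(_ +i* _)%C -!meanD//; congr (mean _ +i* mean _)%C;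
 by apply/funext => y; case: (F y) (G y) => ? ? [? ?].
Qed.

Lemma cmeanZ (a : R) F : ccont F -> cmean (fun x => a%:C%C * F x) = a%:C%C * cmean F.
Proof.
move=> [F1 F2]; rewrite /cmean.
rewrite -[RHS]/(_ +i* _)%C !mul0r subr0 addr0 -!meanZ//; congr (mean _ +i* mean _)%C;
 by apply/funext => y; case: (F y) => ? ? /=; rewrite !mul0r ?subr0 ?addr0.
Qed.

Lemma cmeanB F G : ccont F -> ccont G ->
  cmean (fun x => F x - G x) = cmean F - cmean G.
Proof.
move=> cF cG; rewrite cmeanD//; last exact: ccontN.
congr (_ + _); rewrite -mulN1r -(rmorphN1 (real_complex R)) -cmeanZ//.
by apply: eq_cmean => x; rewrite rmorphN1 mulN1r.
Qed.

Lemma Re_cmean_le F (M : R) : ccont F ->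
  (forall x, `|F x| <= M%:C%C) -> `|complex.Re (cmean F)| <= M.
Proof.
move=> [F1 F2] FM; apply: le_normr_mean => // x.
by rewrite -lecR (le_trans (normc_ge_Re _)).
Qed.

Lemma Im_cmean_le F (M : R) : ccont F ->
  (forall x, `|F x| <= M%:C%C) -> `|complex.Im (cmean F)| <= M.
Proof.
move=> [F1 F2] FM; apply: le_normr_mean => // x.
rewrite -lecR (le_trans _ (FM x))//.
(* Up to sign the imaginary part is the real part of [F x * 'i], and ['i] has modulus one. *)
have := normc_ge_Re (F x * 'i%C); rewrite ReiNIm normrN normrM.
suff -> : `|'i%C : R[i]| = 1 by rewrite mulr1.
by rewrite normc_def/= expr0n expr1n add0r sqrtr1.
Qed.

End CircleMean.

(** * Fourier coefficients of rational functions on the unit circle *)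

Section Circle.
Variable R : realType.
Implicit Types (a b x y : R).
Local Notation expi := (@expi R).

Lemma expiD x y : expi (x + y) = expi x * expi y.
Proof.
by rewrite /Defs.expi cosD sinD; congr (_ +i* _)%C; rewrite addrC.
Qed.

Lemma expi0 : expi 0 = 1.
Proof. by rewrite /Defs.expi cos0 sin0. Qed.

Lemma expi_neq0 x : expi x != 0.
Proof.
apply/eqP => h; have := expi0; rewrite -(subrr x) expiD h mul0r => /eqP.
by rewrite eq_sym oner_eq0.
Qed.

Lemma expiV x : (expi x)^-1 = expi (- x).
Proof.
by apply: (mulfI (expi_neq0 x)); rewrite divff ?expi_neq0// -expiD subrr expi0.
Qed.

Lemma expiX x n : expi x ^+ n = expi (n%:R * x).
Proof.
elim: n => [|n IHn]; first by rewrite mul0r expi0.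
by rewrite exprS IHn -expiD mulrS mulrDl mul1r.
Qed.

Lemma norm_expi x : `|expi x| = 1.
Proof. by rewrite normc_def/= cos2Dsin2 sqrtr1. Qed.

Lemma expiDV x : expi x + (expi x)^-1 = (2 * cos x)%:C%C.
Proof.
rewrite expiV /Defs.expi cosN sinN; congr (_ +i* _)%C; first by rewrite mulr2n mulrDl mul1r.
by rewrite subrr.
Qed.

(** The primitives are sin(kx)/k and -cos(kx)/k, and the two trigonometric hypotheses make them
    close up over [0, 2 pi]. A real k serves positive and negative powers of [expi] alike. *)
Lemma cmean_expi_scale (k : R) : k != 0 -> sin (k * (pi *+ 2)) = 0 ->
  cos (k * (pi *+ 2)) = 1 -> cmean (fun x => expi (k * x)) = 0.
Proof.
move=> k0 sk ck.
have dk x : is_derive x (1 : R) (fun y => k * y) k.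
  apply: is_derive_eq (is_deriveZ k (is_derive_id x (1 : R))) _.
  by rewrite /GRing.scale/= mulr1.
rewrite /cmean /=; congr (_ +i* _)%C.
- apply: (@mean_derive _ _ (fun x => k^-1 * sin (k * x))).
  + by move=> x; apply: continuous_comp; [exact: mulrl_continuous|exact: continuous_cos].
  + move=> x.
    apply: is_derive_eq (is_deriveZ k^-1 (is_derive1_comp (is_derive_sin (k * x)) (dk x))) _.
    by rewrite /GRing.scale /=; field.
  + by rewrite sk !mulr0 sin0 mulr0.
- apply: (@mean_derive _ _ (fun x => - k^-1 * cos (k * x))).
  + by move=> x; apply: continuous_comp; [exact: mulrl_continuous|exact: continuous_sin].
  + move=> x.
    apply: is_derive_eq (is_deriveZ (- k^-1) (is_derive1_comp (is_derive_cos (k * x)) (dk x))) _.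
    by rewrite /GRing.scale /=; field.
  + by rewrite ck !mulr0 cos0.
Qed.

Lemma sin_cos_periodn n :
  sin (n%:R * (pi *+ 2)) = 0 :> R /\ cos (n%:R * (pi *+ 2)) = 1 :> R.
Proof.
rewrite mulr_natl -(add0r (_ *+ n)); split.
  by rewrite (periodicn (@sinD2pi R)) sin0.
by rewrite (periodicn (@cosD2pi R)) cos0.
Qed.

Lemma cmean_expiX n : cmean (fun x => expi x ^+ n) = (n == 0)%N%:R.
Proof.
case: n => [|n] /=; first by rewrite /cmean /= !mean_cst.
rewrite (eq_cmean (fun x => expiX x n.+1)).
by have [s c] := sin_cos_periodn n.+1; rewrite cmean_expi_scale// pnatr_eq0.
Qed.

Lemma cmean_expiVX n : cmean (fun x => (expi x)^-1 ^+ n.+1) = 0.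
Proof.
rewrite (_ : (fun x => _) = fun x => expi (- n.+1%:R * x)).
  have [s c] := sin_cos_periodn n.+1.
  by rewrite cmean_expi_scale ?oppr_eq0 ?pnatr_eq0// mulNr ?sinN ?cosN// s oppr0.
by apply/funext => x; rewrite expiV expiX mulrN mulNr.
Qed.

Lemma expi_sub_ge a x : (1 - `|a|)%:C%C <= `|expi x - a%:C%C|.
Proof.
apply: le_trans (lerB_dist _ _).
by rewrite norm_expi rmorphB/= normc_def/= expr0n addr0 sqrtr_sqr.
Qed.

Lemma expi_sub_neq0 a x : `|a| < 1 -> expi x - a%:C%C != 0.
Proof.
move=> a1; rewrite -normr_gt0; apply: lt_le_trans (expi_sub_ge a x).
by rewrite ltcR subr_gt0.
Qed.

Lemma norm_expi_subV a x : `|a| < 1 -> `|(expi x - a%:C%C)^-1| <= ((1 - `|a|)^-1)%:C%C.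
Proof.
move=> a1; rewrite normfV rmorphV/= ?unitfE ?subr_eq0 ?gt_eqF//.
rewrite lef_pV2 ?expi_sub_ge// posrE ?normr_gt0 ?expi_sub_neq0//.
by rewrite ltcR subr_gt0.
Qed.

Lemma ccont_expi_subV a : `|a| < 1 -> ccont (fun x => (expi x - a%:C%C)^-1).
Proof.
move=> a1; apply: ccontV => [|x]; last exact: expi_sub_neq0.
by apply: ccontD; [exact: ccont_expi|exact: ccont_cst].
Qed.

Lemma ccont_expiV : ccont (fun x => (expi x)^-1).
Proof. by apply: ccontV => [|x]; [exact: ccont_expi|exact: expi_neq0]. Qed.

(* The negative Fourier coefficients satisfy [c_m = a c_(m+1)] and are bounded, so c_0 = a^m c_m -> 0. *)
Lemma cmean_expi_subV a : `|a| < 1 -> cmean (fun x => (expi x - a%:C%C)^-1) = 0.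
Proof.
move=> a1.
pose c m := cmean (fun x => (expi x)^-1 ^+ m * (expi x - a%:C%C)^-1).
have ccF m : ccont (fun x => (expi x)^-1 ^+ m * (expi x - a%:C%C)^-1).
  by apply: ccontM; [apply: ccontX; exact: ccont_expiV|exact: ccont_expi_subV].
have cS m : c m = a%:C%C * c m.+1.
  rewrite -[RHS]add0r -(cmean_expiVX m) -cmeanZ// -cmeanD; last 2 first.
  - by apply: ccontX; exact: ccont_expiV.
  - by apply: ccontM => //; exact: ccont_cst.
  apply: eq_cmean => x; rewrite exprSr.
  have := expi_neq0 x; have := expi_sub_neq0 x a1.
  move: (expi x) (a%:C)%C ((expi x)^-1 ^+ m) => z w v h1 h2; field.
  by rewrite h1 h2.
have c0 m : c 0%N = (a ^+ m)%:C%C * c m.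
  elim: m => [|m IHm]; first by rewrite mul1r.
  by rewrite IHm cS mulrA -rmorphM/= -exprSr.
have cle x m : `|(expi x)^-1 ^+ m * (expi x - a%:C%C)^-1| <= ((1 - `|a|)^-1)%:C%C.
  by rewrite normrM normrX normfV norm_expi invr1 expr1n mul1r norm_expi_subV.
have lim0 (u : R) : (forall m, `|u| <= `|a| ^+ m * (1 - `|a|)^-1) -> u = 0.
  move=> ule; apply/eqP; rewrite -normr_le0.
  have h : `|a| ^+ m * (1 - `|a|)^-1 @[m --> \oo] --> 0.
    rewrite -(mul0r (1 - `|a|)^-1); apply: cvgMr_tmp; apply: cvg_expr.
    by rewrite normr_id.
  by apply: cvgr_to_ge h _; apply: nearW => m; exact: ule.
rewrite (_ : cmean _ = c 0%N); last first.
  by apply: eq_cmean => x; rewrite expr0 mul1r.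
apply/eqP; rewrite eq_complex; apply/andP; split; apply/eqP; apply: lim0 => m.
  rewrite (c0 m) -[X in `|X|]/(_ - _) /= mul0r subr0 normrM normrX ler_wpM2l ?exprn_ge0//.
  exact: Re_cmean_le.
rewrite (c0 m) -[X in `|X|]/(_ + _) /= mul0r addr0 normrM normrX ler_wpM2l ?exprn_ge0//.
exact: Im_cmean_le.
Qed.

(** Cauchy's formula for z^n; the extra power of z comes from dz = iz dtheta. The proof iterates
    z^(m+1)/(z-a) = z^m + a z^m/(z-a), where z^m has mean 0 unless m = 0. *)
Lemma cmean_expiX_subV a n : `|a| < 1 ->
  cmean (fun x => expi x ^+ n.+1 * (expi x - a%:C%C)^-1) = (a ^+ n)%:C%C.
Proof.
move=> a1.
have cc m : ccont (fun x => expi x ^+ m * (expi x - a%:C%C)^-1).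
  by apply: ccontM; [apply: ccontX; exact: ccont_expi|exact: ccont_expi_subV].
have step m : cmean (fun x => expi x ^+ m.+1 * (expi x - a%:C%C)^-1)
    = (m == 0)%N%:R + a%:C%C * cmean (fun x => expi x ^+ m * (expi x - a%:C%C)^-1).
  rewrite -(cmean_expiX m) -cmeanZ// -cmeanD; last 2 first.
  - by apply: ccontX; exact: ccont_expi.
  - by apply: ccontM => //; exact: ccont_cst.
  apply: eq_cmean => x; rewrite exprSr.
  have := expi_sub_neq0 x a1.
  by move: (expi x) (a%:C)%C (expi x ^+ m) => z w v h1; field.
elim: n => [|n IHn]; rewrite step.
  rewrite (_ : cmean _ = 0) ?mulr0 ?addr0// -(cmean_expi_subV a1).
  by apply: eq_cmean => x; rewrite expr0 mul1r.
by rewrite IHn add0r -rmorphM/= -exprS.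
Qed.

(** The contour integral of the formula at t = 0, with arbitrary poles; the last factor [expi x]
    comes from dz. *)
Definition circle_moment a b n : R[i] :=
  cmean (fun x => expi x ^+ n * (expi x - (expi x)^-1)
    / ((expi x - a%:C%C) * (expi x - b%:C%C)) * expi x).

(** Partial fractions in z, together with z^n (z - 1/z) z = z^(n+2) - z^n. The case n = 0 is
    separate because 1/(z-a) has mean 0, not a^(-1). *)
Lemma circle_momentE a b n : `|a| < 1 -> `|b| < 1 -> a != b ->
  circle_moment a b n = ((a - b)^-1 * ((a ^+ n.+1 - b ^+ n.+1)
     - (if n is m.+1 then a ^+ m - b ^+ m else 0)))%:C%C.
Proof.
move=> a1 b1 ab.
have cc m c : `|c| < 1 -> ccont (fun x => expi x ^+ m * (expi x - c%:C%C)^-1).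
  by move=> ?; apply: ccontM; [apply: ccontX; exact: ccont_expi|exact: ccont_expi_subV].
pose D m x := expi x ^+ m * (expi x - a%:C%C)^-1 - expi x ^+ m * (expi x - b%:C%C)^-1.
have ccD m : ccont (D m) by apply: ccontD; [exact: cc|apply: ccontN; exact: cc].
transitivity (((a - b)^-1)%:C%C * (cmean (D n.+2) - cmean (D n))).
  rewrite -cmeanB// -cmeanZ; last by apply: ccontD => //; exact: ccontN.
  apply: eq_cmean => x; rewrite /D !exprSr rmorphV ?unitfE ?subr_eq0// rmorphB/=.
  have abc : a%:C%C - b%:C%C != 0 :> R[i].
    by rewrite -rmorphB; apply: contra ab => /eqP[/eqP]; rewrite subr_eq0.
  have := expi_neq0 x; have := expi_sub_neq0 x a1; have := expi_sub_neq0 x b1.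
  move: abc.
  move: (expi x) (a%:C)%C (b%:C)%C (expi x ^+ n) => z u v w h1 h2 h3 h4; field.
  by rewrite h1 h2 h3 h4.
rewrite rmorphM /=; congr (_ * _).
rewrite rmorphB/= rmorphB/=; congr (_ - _).
  by rewrite cmeanB ?cmean_expiX_subV//; exact: cc.
case: n => [|m]; last by rewrite cmeanB ?cmean_expiX_subV ?rmorphB//; exact: cc.
by rewrite /D cmeanB; [|exact: cc|exact: cc];
  rewrite (eq_cmean (fun x => mul1r _)) (eq_cmean (fun x => mul1r _)) !cmean_expi_subV// subrr.
Qed.

End Circle.

(** * The moment recurrence and the contour formula *)

Section Recurrence.
Variable K : fieldType.
Implicit Types (p q r : K) (F G : nat -> nat -> K).

(* The moments [F t n = \int lambda^t Q_n dpsi] obey this system, by orthogonality at [t = 0] and the three-term recurrence for the step; it determines them. *)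
Definition moment_system p q r F : Prop :=
  [/\ forall n, F 0%N n = (n == 0)%N%:R, forall t, F t.+1 0%N = F t 1%N
    & forall t n, F t.+1 n.+1 = q * F t n + r * F t n.+1 + p * F t n.+2].

(** Row t + 1 is computed from row t, so induction on t, for all n at once, suffices. *)
Lemma moment_system_uniq p q r F G :
  moment_system p q r F -> moment_system p q r G -> forall t n, F t n = G t n.
Proof.
move=> [F0 Fb FS] [G0 Gb GS]; elim=> [|t IHt] n; first by rewrite F0 G0.
by case: n => [|n]; [rewrite Fb Gb IHt|rewrite FS GS !IHt].
Qed.

End Recurrence.

(** * The poles, the contour integral and its recurrences *)

Section Contour.
Variable R : realType.
Implicit Types p q r : R.
Local Notation expi := (@expi R).
Local Notation s p q := (Num.sqrt (p / q)).
Local Notation u q r := (q / (q + r)).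

Definition chain_params p q r : Prop :=
  [/\ 0 < p, 0 < q, 0 < r, p + q + r = 1 & p < q].

Lemma sqrt_ratio_gt0 p q r : chain_params p q r -> 0 < s p q.
Proof. by case=> hp hq *; rewrite sqrtr_gt0 divr_gt0. Qed.

Lemma sqrt_ratio_lt1 p q r : chain_params p q r -> s p q < 1.
Proof. by case=> *; rewrite -sqrtr1 ltr_sqrt// ltr_pdivrMr// mul1r. Qed.

Lemma mul_sqr_sqrt_ratio p q r : chain_params p q r -> q * s p q ^+ 2 = p.
Proof.
case=> *; rewrite sqr_sqrtr ?divr_ge0 ?ltW// mulrCA divff ?mulr1// gt_eqF//.
Qed.

Lemma sqrt_mul_ratio p q r : chain_params p q r -> Num.sqrt (p * q) = q * s p q.
Proof.
move=> H; rewrite (_ : p * q = (q * s p q) ^+ 2).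
  by case: H => *; rewrite sqrtr_sqr ger0_norm// mulr_ge0 ?sqrtr_ge0 ?ltW.
by rewrite exprMn [q ^+ 2]expr2 -mulrA (mul_sqr_sqrt_ratio H) mulrC.
Qed.

Lemma sqrt_ratioV p q r : chain_params p q r -> Num.sqrt (q / p) = (s p q)^-1.
Proof. by case=> *; rewrite -sqrtrV ?invf_div// divr_ge0 ?ltW. Qed.

Lemma pole1E p q r : chain_params p q r ->
  s p q * (r + (1 + q - p)) / (2 * (q + r)) = s p q.
Proof.
case=> *; have q0 : q + r != 0 by rewrite gt_eqF// addr_gt0.
rewrite (_ : r + _ = 2 * (q + r)); last by lra.
by rewrite mulfK// mulf_neq0// pnatr_eq0.
Qed.

Lemma pole2E p q r : chain_params p q r ->
  s p q * (r - (1 + q - p)) / (2 * (q + r)) = - (s p q * u q r).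
Proof.
case=> *; have q0 : q + r != 0 by rewrite gt_eqF// addr_gt0.
rewrite (_ : r - _ = - (2 * q)); last by lra.
by field.
Qed.

Lemma atom_gt0 p q r : chain_params p q r -> 0 < u q r.
Proof. by case=> *; rewrite divr_gt0// addr_gt0. Qed.

Lemma atom_lt1 p q r : chain_params p q r -> u q r < 1.
Proof. by case=> *; rewrite ltr_pdivrMr ?addr_gt0// mul1r ltrDl. Qed.

Lemma norm_pole1_lt1 p q r : chain_params p q r -> `|s p q| < 1.
Proof.
by move=> H; rewrite gtr0_norm ?(sqrt_ratio_gt0 H) ?(sqrt_ratio_lt1 H).
Qed.

Lemma norm_pole2 p q r : chain_params p q r -> `|- (s p q * u q r)| = s p q * u q r.
Proof.
by move=> H; rewrite normrN gtr0_norm// mulr_gt0 ?(sqrt_ratio_gt0 H) ?(atom_gt0 H).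
Qed.

Lemma norm_pole2_lt1 p q r : chain_params p q r -> `|- (s p q * u q r)| < 1.
Proof.
move=> H; rewrite (norm_pole2 H).
by rewrite mulr_ilt1 ?sqrtr_ge0 ?(ltW (atom_gt0 H)) ?(sqrt_ratio_lt1 H) ?(atom_lt1 H).
Qed.

(** On the circle z + 1/z = 2 cos x and sqrt(pq) = q s, so the factor raised to the power t is real.
    The poles are in simplified form. *)
Definition integrand p q r t n x : R[i] :=
  (2 * (q * s p q) * cos x + r)%:C%C ^+ t * (expi x ^+ n * (expi x - (expi x)^-1)
    / ((expi x - (s p q)%:C%C) * (expi x - (- (s p q * u q r))%:C%C)) * expi x).

Lemma symbolE p q r x : (2 * (q * s p q) * cos x + r)%:C%C =
  (q * s p q)%:C%C * (expi x + (expi x)^-1) + r%:C%C.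
Proof. by rewrite expiDV -rmorphM -rmorphD/=; congr (_%:C)%C; ring. Qed.

Lemma contourE p q r t n : chain_params p q r ->
  contour (cf p q r t n) = cmean (integrand p q r t n).
Proof.
move=> H; apply: eq_cmean => x; rewrite /cf /integrand symbolE.
by rewrite (pole1E H) (pole2E H) (sqrt_mul_ratio H) !mulrA.
Qed.

Lemma ccont_integrand p q r t n : chain_params p q r -> ccont (integrand p q r t n).
Proof.
move=> H; have cE := @ccont_expi R; have cV := @ccont_expiV R.
apply: ccontM.
  apply: ccontX; rewrite (_ : (fun x => _) = fun x =>
      (q * s p q)%:C%C * (expi x + (expi x)^-1) + r%:C%C).
    apply: ccontD; last exact: ccont_cst.
    by apply: ccontM; [exact: ccont_cst|exact: ccontD].
  by apply/funext => x; rewrite symbolE.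
apply: ccontM => //; apply: ccontM; last first.
  apply: ccontV => [|x].
    by apply: ccontM; apply: ccontD => //; exact: ccont_cst.
  by rewrite mulf_neq0// expi_sub_neq0// ?(norm_pole1_lt1 H) ?(norm_pole2_lt1 H).
by apply: ccontM; [exact: ccontX|apply: ccontD => //; exact: ccontN].
Qed.

(** An identity of integrands: one factor sqrt(pq)(z + 1/z) + r splits off, and z and 1/z shift the
    exponent n + 1 up and down. *)
Lemma contour_step p q r t n : chain_params p q r ->
  contour (cf p q r t.+1 n.+1) = (q * s p q)%:C%C * contour (cf p q r t n)
    + r%:C%C * contour (cf p q r t n.+1)
    + (q * s p q)%:C%C * contour (cf p q r t n.+2).
Proof.
move=> H; have cc m k := @ccont_integrand p q r m k H.
have cZ (a : R) m k : ccont (fun x => a%:C%C * integrand p q r m k x).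
  by apply: ccontM => //; exact: ccont_cst.
rewrite !(contourE _ _ H) -!cmeanZ// -!cmeanD//; last exact: ccontD.
apply: eq_cmean => x; rewrite /integrand symbolE !exprSr.
have := expi_neq0 x; set w := (_ * (expi x - (- _)%:C%C))^-1; move: w => w.
set v := (_ ^+ t); move: v => v; move: (expi x ^+ n) (expi x) (q * s p q)%:C%C r%:C%C => y z a b z0; field.
by [].
Qed.

Lemma ccont_odd_symbol (a b : R) t :
  ccont (fun x => (a * cos x + b)%:C%C ^+ t * (expi x - (expi x)^-1)).
Proof.
have cE := @ccont_expi R; have cV := @ccont_expiV R.
apply: ccontM; last by apply: ccontD => //; exact: ccontN.
apply: ccontX; split=> x; last exact: cst_continuous.
by apply: cvgD; [apply: cvgMl_tmp; exact: continuous_cos|exact: cvg_cst].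
Qed.

(** Up to a factor, the primitive is (a cos x + b)^(t+1), which is periodic; [k] is the factor that
    turns its derivative into the integrand. *)
Lemma mean_odd_symbol (a b : R) t : a != 0 ->
  mean (fun x => (a * cos x + b) ^+ t * (2 * sin x)) = 0.
Proof.
move=> a0; pose f x := a * cos x + b.
pose k : R := - 2 / (a * t.+1%:R).
have kE : k * (t.+1%:R * a) = - 2.
  by rewrite /k [t.+1%:R * a]mulrC mulfVK// mulf_neq0// pnatr_eq0.
apply: (@mean_derive _ _ (k \*: (f ^+ t.+1))).
- move=> x; apply: cvgM; last by apply: cvgMl_tmp; exact: continuous_sin.
  have cf : {for x, continuous f}.
    by apply: cvgD; [apply: cvgMl_tmp; exact: continuous_cos|exact: cvg_cst].
  exact: continuous_comp cf (@exprn_continuous R t (f x)).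
- move=> x.
  have df : is_derive x (1 : R) f (a * - sin x).
    apply: is_derive_eq (is_deriveD (is_deriveZ a (is_derive_cos x)) (is_derive_cst b x 1)) _.
    by rewrite addr0.
  apply: is_derive_eq (is_deriveZ _ (is_deriveX t.+1 df)) _.
  rewrite /GRing.scale/= -/(f x); move: (f x ^+ t) (sin x) => y z.
  rewrite (_ : k * _ = - (k * (t.+1%:R * a)) * (y * z)); last by ring.
  by rewrite kE opprK; ring.
- by rewrite exprfctE; congr (k * _ ^+ _); rewrite /f cos2pi cos0.
Qed.

Lemma cmean_odd_symbol (a b : R) t : a != 0 ->
  cmean (fun x => (a * cos x + b)%:C%C ^+ t * (expi x - (expi x)^-1)) = 0.
Proof.
move=> a0.
(* On the circle z - 1/z = 2i sin x, so the function is purely imaginary. *)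
have E : (fun x => (a * cos x + b)%:C%C ^+ t * (expi x - (expi x)^-1)) =
    fun x => (0 +i* ((a * cos x + b) ^+ t * (2 * sin x)))%C.
  apply/funext => x; rewrite -rmorphXn/= expiV /Defs.expi cosN sinN.
  rewrite -[X in _ * X]/(_ +i* _)%C -[LHS]/(_ +i* _)%C !subrr !(mul0r, mulr0) subrr addr0.
  by rewrite /= opprK mulr2n mulrDl mul1r.
by rewrite E /cmean /= mean_cst mean_odd_symbol.
Qed.

Lemma contour_step0 p q r t : chain_params p q r ->
  contour (cf p q r t.+1 0) = ((s p q)^-1)%:C%C * contour (cf p q r t 1).
Proof.
move=> H; have cc m k := @ccont_integrand p q r m k H.
have s0 := sqrt_ratio_gt0 H.
have sC : (s p q)%:C%C != 0 :> R[i] by rewrite fmorph_eq0 gt_eqF.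
have q0 : (q + r)%:C%C != 0 :> R[i] by rewrite fmorph_eq0; case: H => *; rewrite gt_eqF// addr_gt0.
apply/eqP; rewrite -subr_eq0 !(contourE _ _ H) -cmeanZ// -cmeanB//; last first.
  by apply: ccontM => //; exact: ccont_cst.
(* Since q s^2 = p = 1 - q - r, z(sqrt(pq)(z + 1/z) + r - z/s) = -((q+r)/s)(z - s)(z + su). Both
   poles cancel, and the difference of the integrands is -(q+r)/s times the odd one. *)
apply/eqP; rewrite -[RHS](mulr0 (- ((q + r) / s p q))%:C%C).
rewrite -(@cmean_odd_symbol (2 * (q * s p q)) r t); last first.
  by case: (H) => *; rewrite !mulf_neq0 ?pnatr_eq0 ?gt_eqF.
rewrite -cmeanZ; last exact: ccont_odd_symbol.
apply: eq_cmean => x; rewrite /integrand symbolE !exprSr expr0.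
have := expi_sub_neq0 x (norm_pole1_lt1 H).
have := expi_sub_neq0 x (norm_pole2_lt1 H).
have : (q * s p q ^+ 2)%:C%C = 1 - q%:C%C - r%:C%C :> R[i].
  rewrite (mul_sqr_sqrt_ratio H); transitivity ((1 - q - r)%:C%C : R[i]).
    by congr (_%:C)%C; case: H => *; lra.
  by rewrite !rmorphB/=.
have := expi_neq0 x.
rewrite !(rmorphM,rmorphD,rmorphN, rmorphV) ?unitfE ?(gt_eqF s0)//=.
set v := (_ ^+ t); move: v (expi x) sC q0 => v z. rewrite rmorphD/=.
move: (s p q)%:C%C q%:C%C r%:C%C => a b d a0 d0 z0 hs h2 h1.
  field: hs; rewrite z0 a0 d0 h1 andbT/=.
  (* The second pole factor, cleared of the denominator q + r. *)
  have -> : z * (b + d) - - (a * b) = (b + d) * (z - - (a * u b d)) by field.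
  exact: mulf_neq0.
by case: H => *; rewrite gt_eqF// addr_gt0.
Qed.

End Contour.

(** * The closed formula as a solution of the moment system *)

Section Formula.
Variable R : realType.
Implicit Types p q r : R.
Local Notation expi := (@expi R).
Local Notation s p q := (Num.sqrt (p / q)).
Local Notation u q r := (q / (q + r)).

(** This is 1/rho, the stationary weight of state 0. *)
Definition nu0 p q : R := (q - p) / (1 + q - p).

Definition mass p q r : R := ((1 + q - p) * (q + r) - q) / ((1 + q - p) * (q + r)).

Definition spectral_formula p q r t n : R[i] :=
  ((mass p q r * (- u q r) ^+ (t + n))%:C
   + ((Num.sqrt (q / p)) ^+ n * (p / (q + r)))%:C * contour (cf p q r t n))%C.

(** The roots of v^2 = q + r v + p v^2 are 1 and -u. Hence (-u)^(t+n) satisfies the recurrence of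
    the moments for n >= 1. *)
Lemma atom_char p q r : chain_params p q r ->
  (- u q r) ^+ 2 = q + r * (- u q r) + p * (- u q r) ^+ 2.
Proof.
move=> [hp hq hr hsum _]; have q0 : q + r != 0 by rewrite gt_eqF// addr_gt0.
by have -> : p = 1 - (q + r); [lra|field].
Qed.

Lemma spectral_formula0 p q r n : chain_params p q r ->
  (nu0 p q)%:C%C + spectral_formula p q r 0 n = (n == 0)%N%:R.
Proof.
move=> H; have [hp hq hr hsum hqp] := H.
have s0 := sqrt_ratio_gt0 H; have u0 := atom_gt0 H.
rewrite /spectral_formula (contourE _ _ H).
rewrite (_ : cmean _ = circle_moment (s p q) (- (s p q * u q r)) n); last first.
  by apply: eq_cmean => x; rewrite /integrand expr0 mul1r.
rewrite circle_momentE ?(norm_pole1_lt1 H) ?(norm_pole2_lt1 H)//; last first.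
  by rewrite eq_sym lt_eqF// (lt_trans _ s0)// oppr_lt0 mulr_gt0.
rewrite -rmorphM -!rmorphD/= -[RHS](rmorph_nat (real_complex R)); congr (_%:C)%C.
rewrite (sqrt_ratioV H) -[- (s p q * _)]mulrN.
have q0 : q + r != 0 by rewrite gt_eqF// addr_gt0.
have s2 : s p q ^+ 2 = p / q.
  by rewrite sqr_sqrtr// divr_ge0 ?ltW.
have d0 : 1 + q - p != 0 by rewrite gt_eqF//; lra.
have qr : r = 1 - p - q by lra.
have k0 : q + r + q != 0 by rewrite gt_eqF//; lra.
have sn0 : s p q != 0 by rewrite gt_eqF.
have E : s p q - s p q * - u q r = s p q * ((q + r + q) / (q + r)) by field.
rewrite E /nu0 /mass; case: n => [|m].
  (* For n = 0 the three weights [nu0], [mass] and p/(q+r) add up to one. *)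
  rewrite /= subr0 !expr1 !expr0 !mulr1 mul1r E mulVf ?mulr1.
    by rewrite qr; field; rewrite d0 -{1}qr q0.
  by rewrite mulf_neq0// mulf_neq0// invr_eq0.
rewrite /= add0n !exprMn !exprS exprVn.
move: (s p q ^+ m) (expf_neq0 m sn0) => S S0; move: (_ ^+ m) => X.
(* For n = m + 1 all powers of s cancel except s^(-2) = q/p. The constant terms then cancel [nu0],
   and the multiples of X = (-u)^m cancel the [mass] term. *)
have -> : (s p q)^-1 / S * (p / (q + r)) *
   ((s p q * ((q + r + q) / (q + r)))^-1 *
    (s p q * (s p q * S) - s p q * (s p q * S) * (- u q r * (- u q r * X)) -
     (S - S * X))) =
   p / (q + r + q) * (1 - u q r ^+ 2 * X - (1 - X) / s p q ^+ 2).
  by move: (s p q) sn0 => a a0; field; rewrite a0 S0 q0 k0.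
rewrite s2; move: q0 k0 d0; rewrite qr => q0 k0 d0; field.
by rewrite q0 k0 !gt_eqF.
Qed.

Lemma spectral_formula_step0 p q r t : chain_params p q r ->
  spectral_formula p q r t.+1 0 = spectral_formula p q r t 1.
Proof.
move=> H; rewrite /spectral_formula (contour_step0 _ H) addn0 addn1; congr (_ + _).
rewrite mulrA -rmorphM/= (sqrt_ratioV H); congr (_%:C%C * _).
by rewrite mul1r mulrC.
Qed.

Lemma spectral_formula_step p q r t n : chain_params p q r ->
  spectral_formula p q r t.+1 n.+1 = q%:C%C * spectral_formula p q r t n
    + r%:C%C * spectral_formula p q r t n.+1 + p%:C%C * spectral_formula p q r t n.+2.
Proof.
move=> H; have sn0 : s p q != 0 by rewrite gt_eqF ?(sqrt_ratio_gt0 H).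
rewrite /spectral_formula (contour_step _ _ H) (sqrt_ratioV H).
have E1 : mass p q r * (- u q r) ^+ (t.+1 + n.+1) =
    q * (mass p q r * (- u q r) ^+ (t + n)) + r * (mass p q r * (- u q r) ^+ (t + n.+1))
    + p * (mass p q r * (- u q r) ^+ (t + n.+2)).
  rewrite addSn !addnS !exprS; have := atom_char H.
  move: (mass p q r) (- u q r) => w v h; set X := v ^+ _.
  transitivity (w * X * v ^+ 2); [ring|rewrite h; ring].
move: (p / (q + r)) => k.
(* The symmetric weight sqrt(pq) = q s becomes q after lowering the power of 1/s by one, and p after
   raising it by one, as q s^2 = p. *)
have E2 : (s p q)^-1 ^+ n.+1 * k * (q * s p q) = q * ((s p q)^-1 ^+ n * k).
  by rewrite exprSr; set X := _ ^+ n; field.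
have E3 : (s p q)^-1 ^+ n.+1 * k * (q * s p q) = p * ((s p q)^-1 ^+ n.+2 * k).
  by have ps := mul_sqr_sqrt_ratio H; rewrite !exprS; set X := _ ^+ n; field: ps.
rewrite !mulrDr !mulrA -!rmorphM/= {1}E2 E3 {}E1 !rmorphD/=.
rewrite [_ * r]mulrC !rmorphM/=.
move: (contour _) (contour _) (contour _) => c0 c1 c2.
ring.
Qed.

Lemma moment_system_formula p q r : chain_params p q r ->
  moment_system p%:C%C q%:C%C r%:C%C
    (fun t n => (nu0 p q)%:C%C + spectral_formula p q r t n).
Proof.
move=> H; split=> [n|t|t n]; first exact: spectral_formula0.
  by rewrite spectral_formula_step0.
rewrite spectral_formula_step//.
(* The constant [nu0] passes through the recurrence because the weights sum to one. *)
have E : (q + r + p)%:C%C = 1 :> R[i].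
  by case: H => _ _ _ h _; rewrite (_ : q + r + p = 1)// -h; ring.
rewrite -[X in X + _ = _]mul1r -E !rmorphD/=; ring.
Qed.

Lemma norm_real_complex (x : R) : `|x%:C%C| = `|x|%:C%C.
Proof. by rewrite normc_def/= expr0n addr0 sqrtr_sqr. Qed.

(** Factor by factor on the circle: the real symbol is at most r + 2qs in modulus, |z - 1/z| <= 2,
    and |z - a| >= 1 - |a| at each pole. *)
Lemma Re_contour_le p q r t n : chain_params p q r ->
  `|complex.Re (contour (cf p q r t n))| <=
     (r + 2 * (q * s p q)) ^+ t * (2 / ((1 - s p q) * (1 - s p q * u q r))).
Proof.
move=> H; rewrite (contourE _ _ H); apply: Re_cmean_le; first exact: ccont_integrand.
move=> x; have [hp hq hr _ _] := H.
have k0 : 0 <= 2 * (q * s p q) by rewrite !mulr_ge0 ?ltW ?(sqrt_ratio_gt0 H).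
rewrite /integrand normrM [X in _ <= X]rmorphM; apply: ler_pM => //=.
  rewrite rmorphXn/= normrX lerXn2r ?nnegrE ?normr_ge0 ?ler0c ?addr_ge0 ?(ltW hr)//.
  rewrite norm_real_complex lecR (le_trans (ler_normD _ _))// addrC.
  rewrite (gtr0_norm hr) lerD2l normrM ger0_norm// ler_piMr// cos_max//.
rewrite !normrM norm_expi mulr1 normrX norm_expi expr1n mul1r.
rewrite rmorphM/=; apply: ler_pM => //.
  apply: le_trans (ler_normB _ _) _.
  by rewrite normfV norm_expi invr1 rmorph_nat.
rewrite invfM normrM invfM rmorphM/=; apply: ler_pM => //.
  have := norm_expi_subV x (norm_pole1_lt1 H).
  by rewrite (gtr0_norm (sqrt_ratio_gt0 H)).
by have := norm_expi_subV x (norm_pole2_lt1 H); rewrite (norm_pole2 H).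
Qed.

End Formula.

(** * The spectral measure *)

Section SpectralMeasure.
Variable R : realType.
Implicit Types p q r x : R.

Lemma QSS p q r n x :
  Q p q r n.+2 x = ((x - r) * Q p q r n.+1 x - q * Q p q r n x) / p.
Proof. by rewrite /Q /=; case: (Qpair p q r n x). Qed.

Lemma Q_recurrence p q r n x : p != 0 ->
  x * Q p q r n.+1 x = q * Q p q r n x + r * Q p q r n.+1 x + p * Q p q r n.+2 x.
Proof. by move=> p0; rewrite QSS; field. Qed.

(** Constants are fixed by the transition operator. An atom at 1 therefore adds the same amount to
    every moment. *)
Lemma Q_at1 p q r n : chain_params p q r -> Q p q r n 1 = 1.
Proof.
case=> hp _ _ hsum _; have p0 : p != 0 by rewrite gt_eqF.
suff [] : Q p q r n 1 = 1 /\ Q p q r n.+1 1 = 1 by [].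
elim: n => [//|n [IH1 IH2]]; split=> //.
by rewrite QSS IH1 IH2 (_ : r = 1 - p - q); [field|lra].
Qed.

Lemma continuous_Q p q r n : continuous (Q p q r n).
Proof.
suff [] : continuous (Q p q r n) /\ continuous (Q p q r n.+1) by [].
elim: n => [|n [IH1 IH2]]; first by split=> x; [exact: cst_continuous|exact: cvg_id].
split=> // x; rewrite (_ : Q p q r n.+2 = fun x =>
  ((x - r) * Q p q r n.+1 x - q * Q p q r n x) / p); last by apply/funext => y; rewrite QSS.
apply: cvgMr_tmp; apply: cvgB; last by apply: cvgMl_tmp; exact: IH1.
by apply: cvgM; [apply: cvgB; [exact: cvg_id|exact: cvg_cst]|exact: IH2].
Qed.

Lemma continuous_XQ p q r t n : continuous (fun x => x ^+ t * Q p q r n x).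
Proof.
by move=> x; apply: cvgM; [exact: exprn_continuous|exact: continuous_Q].
Qed.

Lemma integrable_probability_itv (psi : probability R R) (f : R -> R) : continuous f ->
  psi.-integrable `[-1, 1] (EFin \o f).
Proof.
move=> cf; apply: measurable_bounded_integrable => //.
- by rewrite (le_lt_trans (probability_le1 _ _)) ?ltry.
- by apply: measurable_funTS; exact: continuous_measurable_fun.
- have /compact_bounded[M [_ mrt]] :=
    continuous_compact (continuous_subspaceT cf) (@segment_compact R (-1) 1).
  by exists M; split; rewrite ?num_real // => ? ? ? ?; exact: mrt.
Qed.

Definition moment (psi : probability R R) p q r t n : R :=
  Rintegral psi `[-1, 1] (fun x => x ^+ t * Q p q r n x).

Lemma moment_system_moment (psi : probability R R) p q r : p != 0 ->
  is_spectral_measure p q r psi -> moment_system p q r (moment psi p q r).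
Proof.
move=> p0 [_ Qorth]; have cXQ := @continuous_XQ p q r; split=> [n|t|t n].
- transitivity (fine ((if 0%N == n then 1 else 0) / piR p q n)%:E).
    by move: (Qorth 0%N n) => <-; congr fine.
  by case: n => [|n] /=; rewrite /piR/= ?divr1// mul0r.
- by apply: eq_Rintegral => x _; rewrite exprSr mulr1.
- have iXQ m k : psi.-integrable `[-1, 1] (EFin \o (fun x => x ^+ m * Q p q r k x)).
    exact: integrable_probability_itv.
  have iZ (a : R) m k : psi.-integrable `[-1, 1] (EFin \o (fun x => a * (x ^+ m * Q p q r k x))).
    by apply: integrable_probability_itv => x; apply: cvgMl_tmp; exact: cXQ.
  rewrite /moment -!RintegralZl// -!RintegralD//; last first.
    by apply: integrable_probability_itv => x; apply: cvgD; apply: cvgMl_tmp; exact: cXQ.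
  apply: eq_Rintegral => x _; rewrite exprSr -mulrA Q_recurrence//.
  by rewrite !mulrDr; congr (_ + _ + _); rewrite mulrCA.
Qed.

(** The Karlin-McGregor formula with i = 0, for any solution of the moment system. Reversibility
    turns the forward equation for [mu] into the recurrence for F: pi_n P(n,n+1) = pi_(n+1)
    P(n+1,n). *)
Lemma mu_moment p q r (F : nat -> nat -> R) : chain_params p q r ->
  moment_system p q r F -> forall t n, mu p q r t n = piR p q n * F t n.
Proof.
move=> [hp hq _ _ _] [F0 Fb FS].
have p0 : p != 0 by rewrite gt_eqF.
have q0 : q != 0 by rewrite gt_eqF.
have piS k : piR p q k.+2 = p / q * piR p q k.+1.
  by rewrite /piR /= !exprS; field; rewrite expf_neq0.
elim=> [|t IHt] n; first by rewrite /= F0; case: n => [|n] /=; rewrite ?mulr0// /piR mul1r.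
rewrite /=; case: n => [|n].
  rewrite !big_ord_recl big_ord0 /trans/= !IHt Fb /piR /=; field.
  by [].
(* Only the last three indices n, n + 1, n + 2 lead to state n + 1. *)
rewrite !big_ord_recr /= big1 ?add0r; last first.
  move=> i _; rewrite /trans; have := ltn_ord i; case: ifP => [/eqP -> n0|i0 lin].
    by rewrite eqSS gtn_eqF ?mulr0.
  rewrite gtn_eqF ?(leq_ltn_trans (leq_pred i)) ?leqW// gtn_eqF ?leqW// eqSS.
  by rewrite gtn_eqF// mulr0.
rewrite !IHt FS /trans /= !eqSS !eqxx (gtn_eqF (ltnSn n)) piS.
have -> : (n.+1 == n.-1) = false by rewrite gtn_eqF// ltnS leq_pred.
(* State 1 is apart: its lower neighbour 0 moves up with probability 1, and pi_0 is off the
   geometric pattern. *)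
case: n => [|n]; rewrite ?piS /=; last by move: (piR p q n.+1) => P; field; rewrite q0.
by rewrite /piR /=; field; rewrite q0.
Qed.

Lemma Rintegral_itv_ends (psi : probability R R) (f : R -> R) : continuous f ->
  Rintegral psi `[-1, 1] f = Rintegral psi `]-1, 1[ f
    + f 1 * fine (psi [set 1]) + f (-1) * fine (psi [set -1]).
Proof.
move=> cf; have fI := integrable_probability_itv psi cf.
have cst1 (a : R) : Rintegral psi [set a] f = f a * fine (psi [set a]).
  rewrite -Rintegral_cst//; apply: eq_Rintegral => x; rewrite inE => ->.
  by [].
have E1 : `[-1, 1]%classic = `[-1, 1[%classic `|` [set (1 : R)].
  by rewrite setUitv1// bnd_simp; lra.
have E2 : `[-1, 1[%classic = [set (-1 : R)] `|` `]-1, 1[%classic.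
  by rewrite setU1itv// bnd_simp; lra.
have fI1 : psi.-integrable `[-1, 1[ (EFin \o f).
  by apply: integrableS fI => //; rewrite E1; exact: subsetUl.
rewrite [in LHS]E1 Rintegral_setU//; last 2 first.
- by rewrite -E1.
- by apply/disj_setPS => x [/=]; rewrite in_itv/= => /andP[_] /[swap] ->; rewrite ltxx.
rewrite [in LHS]E2 Rintegral_setU//; last 2 first.
- by rewrite -E2.
- by apply/disj_setPS => x [/=] ->; rewrite in_itv/= ltxx.
rewrite !cst1; ring.
Qed.

End SpectralMeasure.

(** * Limits of the moments and the atoms at 1 and -1 *)

Section Atoms.
Variable R : realType.
Implicit Types p q r x : R.
Local Notation s p q := (Num.sqrt (p / q)).
Local Notation u q r := (q / (q + r)).

Lemma symbol_max_lt1 p q r : chain_params p q r -> r + 2 * (q * s p q) < 1.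
Proof.
move=> H; have := sqrt_ratio_lt1 H; have := mul_sqr_sqrt_ratio H.
case: H => hp hq hr hsum _; move: (s p q) => a ha a1.
(* With p = q s^2 and r = 1 - p - q the gap to 1 is a perfect square times q. *)
rewrite -subr_gt0 (_ : _ - _ = q * (1 - a) ^+ 2).
  by rewrite mulr_gt0// exprn_gt0// subr_gt0.
by rewrite (_ : r = 1 - p - q); [rewrite -ha; ring|lra].
Qed.

Lemma symbol_max_gt0 p q r : chain_params p q r -> 0 < r + 2 * (q * s p q).
Proof.
by move=> H; case: (H) => *; rewrite addr_gt0// !mulr_gt0// (sqrt_ratio_gt0 H).
Qed.

Lemma contour_cvg0 p q r n : chain_params p q r ->
  complex.Re (contour (cf p q r t n)) @[t --> \oo] --> 0.
Proof.
move=> H; apply/norm_cvg0P.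
apply: (@squeeze_cvgr _ _ _ _ (fun=> 0) (fun t => (r + 2 * (q * s p q)) ^+ t *
     (2 / ((1 - s p q) * (1 - s p q * u q r))))).
- by apply: nearW => t; rewrite normr_ge0 Re_contour_le.
- exact: cvg_cst.
- rewrite -[X in _ --> X](mul0r (2 / ((1 - s p q) * (1 - s p q * u q r)))).
  apply: cvgMr_tmp; apply: cvg_expr.
  by rewrite gtr0_norm ?(symbol_max_gt0 H) ?(symbol_max_lt1 H).
Qed.

(** Both sides solve the same moment system, read over the complex numbers. *)
Lemma moment_formula (psi : probability R R) p q r t n : chain_params p q r ->
  is_spectral_measure p q r psi ->
  (moment psi p q r t n)%:C%C = (nu0 p q)%:C%C + spectral_formula p q r t n.
Proof.
move=> H hpsi; move: t n; apply: moment_system_uniq (moment_system_formula H).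
have p0 : p != 0 by case: H => *; rewrite gt_eqF.
have [F0 Fb FS] := moment_system_moment p0 hpsi.
split=> [n|t|t n]; first by rewrite F0 rmorph_nat.
  by rewrite Fb.
by rewrite FS !rmorphD/= !rmorphM.
Qed.

Lemma moment_Re (psi : probability R R) p q r t n : chain_params p q r ->
  is_spectral_measure p q r psi ->
  moment psi p q r t n = nu0 p q + complex.Re (spectral_formula p q r t n).
Proof.
move=> H hpsi; have := congr1 (@complex.Re R) (moment_formula t n H hpsi).
by move: (spectral_formula p q r t n) => [a b].
Qed.

Lemma Re_spectral_formula p q r t n :
  complex.Re (spectral_formula p q r t n) = mass p q r * (- u q r) ^+ (t + n)
    + (Num.sqrt (q / p)) ^+ n * (p / (q + r)) * complex.Re (contour (cf p q r t n)).
Proof.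
by rewrite /spectral_formula; move: (contour _) => [a b] /=; rewrite mul0r subr0.
Qed.

Lemma moment_cvg (psi : probability R R) p q r : chain_params p q r ->
  is_spectral_measure p q r psi -> moment psi p q r t 0 @[t --> \oo] --> nu0 p q.
Proof.
move=> H hpsi.
rewrite (_ : (fun t => _) = fun t => nu0 p q + (mass p q r * (- u q r) ^+ t
    + (Num.sqrt (q / p)) ^+ 0 * (p / (q + r)) * complex.Re (contour (cf p q r t 0)))); last first.
  by apply/funext => t; rewrite (moment_Re _ _ H hpsi) Re_spectral_formula addn0.
rewrite -[X in _ --> X]addr0; apply: cvgD; first exact: cvg_cst.
rewrite -[X in _ --> X]addr0; apply: cvgD.
  rewrite -[X in _ --> X](mulr0 (mass p q r)); apply: cvgMl_tmp; apply: cvg_expr.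
  by rewrite normrN gtr0_norm ?(atom_gt0 H) ?(atom_lt1 H).
rewrite -[X in _ --> X](mulr0 ((Num.sqrt (q / p)) ^+ 0 * (p / (q + r)))).
by apply: cvgMl_tmp; exact: contour_cvg0.
Qed.

(** Dominated convergence with the constant 1: x^t tends to 0 at each point of the open interval. *)
Lemma open_moment_cvg0 (psi : probability R R) :
  Rintegral psi `]-1, 1[ (fun x => x ^+ t) @[t --> \oo] --> 0.
Proof.
have [] := @dominated_convergence _ _ R psi `]-1, 1[ (measurable_itv _)
  (fun t x => (x ^+ t)%:E) (cst 0%E) (cst 1%E).
- by move=> t; apply/measurable_EFinP; apply: measurable_funTS; exact: exprn_measurable.
- exact: measurable_cst.
- apply: aeW => x; rewrite /= in_itv/= => /andP[x1 x2].
  apply/cvg_EFin; first exact: nearW.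
  by apply: cvg_expr; rewrite ltr_norml x1 x2.
- apply: (@integrableS _ _ _ psi setT) => //.
  exact: finite_measure_integrable_cst.
- apply: aeW => x n; rewrite /= in_itv/= => /andP[x1 x2].
  by rewrite lee_fin normrX exprn_ile1// ler_norml !ltW.
move=> _ _; rewrite integral0 => h.
exact: fine_cvg h.
Qed.

Lemma atoms (psi : probability R R) p q r : chain_params p q r ->
  is_spectral_measure p q r psi ->
  fine (psi [set 1]) = nu0 p q /\ fine (psi [set -1]) = 0.
Proof.
move=> H hpsi; set a := fine (psi [set 1]); set b := fine (psi [set -1]).
(* This is the closed-interval moment with n = 0 minus the open-interval one. *)
have h : a + (-1) ^+ t * b @[t --> \oo] --> nu0 p q.
  rewrite -[nu0 p q]subr0.
  rewrite (_ : (fun t => _) = fun t =>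
      moment psi p q r t 0 - Rintegral psi `]-1, 1[ (fun x => x ^+ t)).
    by apply: cvgB; [exact: moment_cvg|exact: open_moment_cvg0].
  apply/funext => t; rewrite /moment Rintegral_itv_ends; last exact: continuous_XQ.
  rewrite (_ : Rintegral psi _ (fun x => x ^+ t * _) = Rintegral psi `]-1, 1[ (fun x => x ^+ t)).
    by rewrite expr1n /= /Q/= !mulr1 mul1r -/a -/b; ring.
  by apply: eq_Rintegral => x _; rewrite mulr1.
have h2 : a + (-1) ^+ t.+1 * b @[t --> \oo] --> nu0 p q.
  by have := h; rewrite -(cvg_shiftS (fun t => a + (-1) ^+ t * b)).
have eq_lim (c l : R) : cst c @ \oo --> l -> c = l.
  by move=> cl; apply: (cvg_unique _ (cvg_cst c) cl).
have anu : a = nu0 p q.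
  (* Adding consecutive terms removes b and leaves the constant 2a. *)
  have hs : (a + (-1) ^+ t * b) + (a + (-1) ^+ t.+1 * b) @[t --> \oo]
      --> nu0 p q + nu0 p q by exact: cvgD.
  apply: (@pmulrnI _ 2) => //; rewrite /= !mulr2n; apply: eq_lim.
  suff -> : cst (a + a) = fun t => (a + (-1) ^+ t * b) + (a + (-1) ^+ t.+1 * b) by [].
  by apply/funext => t /=; rewrite exprS; ring.
split=> //; apply/eqP; rewrite -normr_eq0; apply/eqP/eq_lim.
(* Once a is the limit, the constant |b| tends to 0. *)
have hd : `|(a + (-1) ^+ t * b) - a| @[t --> \oo] --> `|nu0 p q - a|.
  by apply: cvg_norm; apply: cvgB; [exact: h|exact: cvg_cst].
move: hd; rewrite -anu subrr normr0.
suff -> : cst `|b| = fun t => `|(a + (-1) ^+ t * b) - a| by [].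
apply/funext => t /=.
by rewrite addrC addKr normrM normrX normrN1 expr1n mul1r.
Qed.

(** The atom at 1 contributes exactly [nu0], as Q_n(1) = 1, and -1 contributes nothing; subtracting
    them from the closed-interval moment leaves the formula. *)
Lemma open_moment_formula (psi : probability R R) p q r t n : chain_params p q r ->
  is_spectral_measure p q r psi ->
  (\int[psi]_(x in `](-1)%R, 1%R[) (x ^+ t * Q p q r n x)%:E)%E
    = (complex.Re (spectral_formula p q r t n))%:E.
Proof.
move=> H hpsi; have [a1 a2] := atoms H hpsi.
have cf := @continuous_XQ R p q r t n.
rewrite -[LHS]fineK; last first.
  apply: integrable_fin_num => //.
  apply: integrableS (integrable_probability_itv psi cf) => //.
  exact: subset_itv_oo_cc.
congr (_%:E); have := Rintegral_itv_ends psi cf.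
rewrite -/(moment psi p q r t n) (moment_Re _ _ H hpsi) a1 a2 mulr0 addr0.
rewrite Q_at1// expr1n !mul1r [RHS]addrC => /addrI ->.
by [].
Qed.

End Atoms.

(** * Total variation and mixing time *)

Section Mixing.
Variable R : realType.
Implicit Types p q r x : R.
Local Notation s p q := (Num.sqrt (p / q)).
Local Notation u q r := (q / (q + r)).

(** A geometric series of ratio py/q after the exceptional term pi_0 = 1. It is used at y = 1 for
    [rho], and at y = u and y = 1/s for the total variation bound. *)
Lemma series_piR p q (y : R) : 0 < p -> 0 < q -> 0 < y -> p * y < q ->
  (\sum_(0 <= n < N) piR p q n * y ^+ n) @[N --> \oo] --> 1 + y / (q - p * y).
Proof.
move=> hp hq hy hpy.
have q0 : q != 0 by rewrite gt_eqF.
have d0 : q - p * y != 0 by rewrite gt_eqF// subr_gt0.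
have E N : \sum_(0 <= n < N.+1) piR p q n * y ^+ n =
    1 + y / (q - p * y) * (1 - (p * y / q) ^+ N).
  elim: N => [|N IHN]; first by rewrite big_nat1 /piR /= !expr0; ring.
  rewrite big_nat_recr//= IHN.
  have -> : piR p q N.+1 * y ^+ N.+1 = y / q * (p * y / q) ^+ N.
    rewrite /piR /= exprS [y ^+ _.+1]exprS expr_div_n exprMn invfM; ring.
  by rewrite [X in _ = _ + _ * (1 - X)]exprS; set g := _ ^+ N; field; rewrite q0 d0.
rewrite -(cvg_shiftS (fun N => \sum_(0 <= n < N) piR p q n * y ^+ n)).
rewrite (_ : (fun N => _) = fun N => 1 + y / (q - p * y) * (1 - (p * y / q) ^+ N)); last first.
  by apply/funext => N; exact: E.
rewrite -[X in 1 + X]mulr1 -[X in 1 + _ * X]subr0.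
apply: cvgD; first exact: cvg_cst.
apply: cvgMl_tmp; apply: cvgB; first exact: cvg_cst.
apply: cvg_expr; rewrite gtr0_norm; first by rewrite ltr_pdivrMr ?mul1r.
by rewrite divr_gt0 ?mulr_gt0.
Qed.

Lemma rhoE p q : 0 < p -> p < q -> rho p q = (1 + q - p) / (q - p).
Proof.
move=> hp hpq; have hq := lt_trans hp hpq.
have h : p * 1 < q by rewrite mulr1.
have := series_piR hp hq ltr01 h.
rewrite (_ : (fun N => _) = fun N => \sum_(0 <= n < N) piR p q n); last first.
  by apply/funext => N; apply: eq_bigr => n _; rewrite expr1n mulr1.
move=> /cvg_lim; rewrite /rho => ->//.
by field; rewrite gt_eqF// subr_gt0.
Qed.

Lemma nuE p q n : 0 < p -> p < q -> nu p q n = piR p q n * nu0 p q.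
Proof. by move=> hp hpq; rewrite /nu rhoE// invf_div. Qed.

Lemma piR_ge0 p q n : 0 < p -> 0 < q -> 0 <= piR p q n.
Proof.
by move=> hp hq; rewrite /piR; case: ifP => // _; rewrite divr_ge0 ?exprn_ge0 ?ltW.
Qed.

Lemma nneseries_EFin (f : nat -> R) (l : R) :
  (\sum_(0 <= n < N) f n) @[N --> \oo] --> l ->
  (\sum_(0 <= n <oo) (f n)%:E = l%:E)%E.
Proof.
move=> fl; apply/cvg_lim => //.
rewrite (_ : (fun _ => _) = EFin \o (fun N => \sum_(0 <= n < N) f n)).
  by apply: cvg_EFin => //; exact: nearW.
by apply/funext => N /=; rewrite sumEFin.
Qed.

Lemma mass_ge0 p q r : chain_params p q r -> 0 <= mass p q r.
Proof.
case=> hp hq hr hsum hqp; rewrite /mass divr_ge0//; last by rewrite mulr_ge0//; lra.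
(* Under p + q + r = 1 the numerator is a sum of visibly nonnegative terms, because p < q < q +
   r. *)
rewrite (_ : _ - q = (q + r) * (q + r - p) + p * r); last first.
  by rewrite (_ : r = 1 - p - q); [ring|lra].
by rewrite addr_ge0// mulr_ge0//; lra.
Qed.

Definition TV_bound p q r t : R :=
  ((1 + q - p) * (q + r) - q) / ((1 + q - p) * (1 - 2 * p)) * (u q r) ^+ t
  + (p / (q + r) * (1 + (Num.sqrt (p * q) - p)^-1))
        / ((1 - s p q * (r + (1 + q - p)) / (2 * (q + r)))
           * (1 + s p q * (r - (1 + q - p)) / (2 * (q + r))))
    * (r + 2 * Num.sqrt (p * q)) ^+ t.

Lemma TV_le (psi : probability R R) p q r t : chain_params p q r ->
  is_spectral_measure p q r psi -> (TV p q r t <= (TV_bound p q r t)%:E)%E.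
Proof.
move=> H hpsi; have [hp hq hr hsum hqp] := H.
have s0 := sqrt_ratio_gt0 H; have s1 := sqrt_ratio_lt1 H.
have u0 := atom_gt0 H; have u1 := atom_lt1 H.
have p0 : p != 0 by rewrite gt_eqF.
pose M : R := (r + 2 * (q * s p q)) ^+ t * (2 / ((1 - s p q) * (1 - s p q * u q r))).
pose c1 := mass p q r * u q r ^+ t; pose c2 := p / (q + r) * M.
(* The constant [nu0] in the moment cancels the stationary weight, leaving pi_n times the spectral
   formula, which is bounded by two geometric sequences. *)
have termE n : `|nu p q n - mu p q r t n| <=
    c1 * (piR p q n * u q r ^+ n) + c2 * (piR p q n * (s p q)^-1 ^+ n).
  rewrite (nuE n hp hqp) (mu_moment H (moment_system_moment p0 hpsi)).
  rewrite (moment_Re _ _ H hpsi) -mulrBr opprD addrA subrr add0r mulrN normrN.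
  rewrite normrM (ger0_norm (piR_ge0 n hp hq)).
  rewrite [X in _ <= X](_ : _ = piR p q n *
      (c1 * u q r ^+ n + c2 * (s p q)^-1 ^+ n)); last by ring.
  rewrite ler_wpM2l ?piR_ge0// Re_spectral_formula (sqrt_ratioV H).
  apply: le_trans (ler_normD _ _) _; apply: lerD.
    rewrite normrM (ger0_norm (mass_ge0 H)) normrX normrN (gtr0_norm u0).
    by rewrite exprD mulrA.
  rewrite normrM ger0_norm; last by rewrite mulr_ge0 ?exprn_ge0 ?divr_ge0 ?invr_ge0 ?addr_ge0 ?ltW.
  rewrite [X in _ <= X](_ : _ = (s p q)^-1 ^+ n * (p / (q + r)) * M); last by rewrite /c2; ring.
  rewrite ler_wpM2l ?Re_contour_le//.
  by rewrite mulr_ge0 ?exprn_ge0 ?divr_ge0 ?invr_ge0 ?addr_ge0 ?ltW.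
have psV : p * (s p q)^-1 = q * s p q.
  by rewrite -{1}(mul_sqr_sqrt_ratio H) expr2 mulrA mulfK ?gt_eqF.
have pu : p * u q r < q.
  by apply: lt_trans hqp; rewrite -[X in _ < X]mulr1 ltr_pM2l.
(* The factor sqrt(q/p)^n = s^(-n) grows, but the series still converges since p/s = qs < q. *)
have psq : p * (s p q)^-1 < q by rewrite psV -[X in _ < X]mulr1 ltr_pM2l.
have sum1 := series_piR hp hq u0 pu.
have sV0 : 0 < (s p q)^-1 by rewrite invr_gt0.
have sum2 := series_piR hp hq sV0 psq.
have sumb : (\sum_(0 <= n < N)
      (c1 * (piR p q n * u q r ^+ n) + c2 * (piR p q n * (s p q)^-1 ^+ n)))
    @[N --> \oo] --> c1 * (1 + u q r / (q - p * u q r))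
      + c2 * (1 + (s p q)^-1 / (q - p * (s p q)^-1)).
  rewrite (_ : (fun N => _) = fun N => c1 * (\sum_(0 <= n < N) piR p q n * u q r ^+ n)
      + c2 * (\sum_(0 <= n < N) piR p q n * (s p q)^-1 ^+ n)).
    by apply: cvgD; apply: cvgMl_tmp.
  by apply/funext => N; rewrite big_split/= -!mulr_sumr.
(* The half in the total variation distance absorbs the 2 from |z - 1/z| <= 2 in B. In A it meets 1
   + u/(q - pu) = 2(q+r)/(1-2p). *)
have -> : TV_bound p q r t = 2^-1 * (c1 * (1 + u q r / (q - p * u q r))
      + c2 * (1 + (s p q)^-1 / (q - p * (s p q)^-1))).
  rewrite /TV_bound (pole1E H) (pole2E H) (sqrt_mul_ratio H).
  have -> : (s p q)^-1 / (q - p * (s p q)^-1) = (q * s p q - p)^-1.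
    rewrite psV -invfM; congr (_^-1); have := mul_sqr_sqrt_ratio H.
    by move: (s p q) => a <-; ring.
  have -> : ((1 + q - p) * (q + r) - q) / ((1 + q - p) * (1 - 2 * p)) =
      2^-1 * (mass p q r * (1 + u q r / (q - p * u q r))).
    rewrite /mass (_ : r = 1 - p - q); last by lra.
    (* Positive because 2p < p + q < 1. *)
    have h : 0 < q * (1 - 2 * p) by rewrite mulr_gt0//; lra.
    field; rewrite !gt_eqF//; lra.
  rewrite /c1 /c2 /M; set X := _ ^+ t; set Y := _ ^+ t.
  set a := (q * _ - _)^-1; move: (mass p q r) (p / (q + r)) => w k.
  by set Z := ((1 - _) * (1 - _))^-1; set b := _ / (q - _); field.
rewrite /TV EFinM lee_pmul2l ?lte_fin ?invr_gt0//.
rewrite -(nneseries_EFin sumb); apply: lee_nneseries => [n _ _|n _].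
  by rewrite lee_fin normr_ge0.
by rewrite lee_fin termE.
Qed.

(** Solving D m^t <= eps for t gives a first time of order ln eps / ln m. Taking eps below both m
    and 1/D absorbs the additive constants into the factor 3. *)
Lemma tmix_le (f : nat -> \bar R) (D m : R) : 0 < m -> m < 1 -> 1 <= D ->
  (forall t, (f t <= (D * m ^+ t)%:E)%E) ->
  forall eps : R, 0 < eps -> eps < Num.min m D^-1 ->
  exists t : nat, [/\ (f t <= eps%:E)%E,
     forall t', (f t' <= eps%:E)%E -> (t <= t')%N & t%:R <= 3 * (ln eps / ln m)].
Proof.
move=> m0 m1 D1 fle eps eps0; rewrite lt_min => /andP[epsm epsD].
have D0 : 0 < D := lt_le_trans ltr01 D1.
have lm : ln m < 0 by rewrite ln_lt0// m0.
pose x := ln (eps / D) / ln m.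
(* The successor makes T exceed x, the real solution of D m^x = eps. *)
pose T := (Num.truncn x).+1.
have fT : (f T <= eps%:E)%E.
  apply: le_trans (fle T) _; rewrite lee_fin -ler_pdivlMl// mulrC.
  rewrite -ler_ln ?posrE ?exprn_gt0 ?divr_gt0// lnXn// -[X in X <= _]mulr_natl.
  by rewrite -ler_ndivrMr// ltW// truncnS_gt.
have exT : exists t, (f t <= eps%:E)%E by exists T.
case: (ex_minnP exT) => t ft tmin; exists t; split=> //.
have eD : ln eps <= - ln D.
  by rewrite -lnV ?posrE// ler_ln ?posrE ?invr_gt0// ltW.
have em : ln eps <= ln m by rewrite ler_ln ?posrE// ltW.
have d0 : 0 <= ln D by exact: ln_ge0.
have xE : x = (ln eps - ln D) / ln m by rewrite /x ln_div ?posrE.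
have lmV : (ln m)^-1 <= 0 by rewrite invr_le0 ltW.
(* Nonnegativity ensures that the truncation of x is at most x. *)
have x0 : 0 <= x by rewrite xE mulr_le0//; lra.
apply: (@le_trans _ _ T%:R); first by rewrite ler_nat tmin.
apply: (@le_trans _ _ (x + 1)); first by rewrite /T -natr1 lerD2r truncn_le.
(* As ln D and -ln m are at most -ln eps, the shift by ln D and the rounding each cost at most one
   further ln eps / ln m. *)
rewrite xE -subr_ge0.
rewrite [X in _ <= X](_ : _ = (2 * ln eps + ln D - ln m) / ln m); last first.
  by field; rewrite lt_eqF.
by rewrite mulr_le0//; lra.
Qed.

End Mixing.

(** * Spectral formula, total variation bound and mixing time together *)

Theorem theorem1 (R : realType) (p q r : R)
  (hp : 0 < p) (hq : 0 < q) (hr : 0 < r) (hsum : p + q + r = 1) (hqp : p < q)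
  (psi : probability R R) (hpsi : is_spectral_measure p q r psi) :
  (forall t n : nat,
     let W : R[i] :=
       (((((1 + q - p) * (q + r) - q) / ((1 + q - p) * (q + r)))
           * (- (q / (q + r))) ^+ (t + n))%:C
        + ((Num.sqrt (q / p)) ^+ n * (p / (q + r)))%:C
          * contour (cf p q r t n))%C in
     (\int[psi]_(x in `](-1)%R, 1%R[) (x ^+ t * Q p q r n x)%:E)%E
       = (complex.Re W)%:E
     /\ complex.Im W = 0)
  /\
  (let A := ((1 + q - p) * (q + r) - q) / ((1 + q - p) * (1 - 2 * p)) in
   let B := (p / (q + r) * (1 + (Num.sqrt (p * q) - p)^-1))
        / ((1 - Num.sqrt (p / q) * (r + (1 + q - p)) / (2 * (q + r)))
           * (1 + Num.sqrt (p / q) * (r - (1 + q - p)) / (2 * (q + r)))) in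
   forall t : nat,
     (TV p q r t <= (A * (q / (q + r)) ^+ t
                     + B * (r + 2 * Num.sqrt (p * q)) ^+ t)%:E)%E)
  /\
  (let m := Num.max (r + 2 * Num.sqrt (p * q)) (q / (q + r)) in
   exists (C eps0 : R), 0 < eps0 /\
     forall eps : R, 0 < eps -> eps < eps0 ->
       exists t : nat, is_tmix p q r eps t /\
         t%:R <= C * (ln eps / ln m)).
Proof.
have H : chain_params p q r by [].
split; [|split].
- move=> t n W; split; first exact: open_moment_formula.
  change (complex.Im (spectral_formula p q r t n) = 0).
  (* The moment and [nu0] are real, so the remaining term is real too. *)
  have := congr1 (@complex.Im R) (moment_formula t n H hpsi).
  by move: (spectral_formula p q r t n) => [a b] /=; rewrite add0r.
- by move=> /= t; exact: (TV_le t H hpsi).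
- set m := Num.max _ _.
  have m0 : 0 < m by rewrite lt_max (atom_gt0 H) orbT.
  have k0 := symbol_max_gt0 H; have k1 := symbol_max_lt1 H.
  have m1 : m < 1 by rewrite gt_max (atom_lt1 H) (sqrt_mul_ratio H) k1.
  set A := ((1 + q - p) * (q + r) - q) / ((1 + q - p) * (1 - 2 * p)).
  set B := (p / (q + r) * (1 + (Num.sqrt (p * q) - p)^-1))
        / ((1 - Num.sqrt (p / q) * (r + (1 + q - p)) / (2 * (q + r)))
           * (1 + Num.sqrt (p / q) * (r - (1 + q - p)) / (2 * (q + r)))).
  (* Absolute values avoid any discussion of signs, and the added 1 gives D >= 1. *)
  pose D := `|A| + `|B| + 1.
  have D1 : 1 <= D by rewrite lerDr addr_ge0.
  have TVm t : (TV p q r t <= (D * m ^+ t)%:E)%E.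
    apply: le_trans (TV_le t H hpsi) _; rewrite lee_fin /TV_bound -/A -/B.
    apply: (@le_trans _ _ (`|A| * m ^+ t + `|B| * m ^+ t)); last first.
      by rewrite -mulrDl ler_wpM2r ?exprn_ge0 ?(ltW m0)// lerDl.
    have le_exp (a y : R) : 0 <= y -> y <= m -> a * y ^+ t <= `|a| * m ^+ t.
      move=> y0 ym; apply: le_trans (ler_wpM2r (exprn_ge0 t y0) (ler_norm a)) _.
      by rewrite ler_wpM2l// lerXn2r// nnegrE// ltW.
    apply: lerD; apply: le_exp.
    - exact: ltW (atom_gt0 H).
    - by rewrite le_max lexx orbT.
    - by rewrite (sqrt_mul_ratio H) ltW.
    - by rewrite le_max lexx.
  exists 3, (Num.min m D^-1); split.
    by rewrite lt_min m0 invr_gt0 (lt_le_trans ltr01 D1).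
  move=> eps e0 em.
  by have [t [h1 h2 h3]] := tmix_le m0 m1 D1 TVm e0 em; exists t; split.
Qed.
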